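(* Consider the electricity market model described in the context, and suppose that the feasibility assumption (A) of the context holds. Then there exists a pure Nash equilibrium, i.e. there exist $v_p^*\in S_p$ for every $p\in P$, $V_c^*\in S_c$ for every $c\in C$, and $E^*\in S_M$ such that (1) $\Psi_p(v_p,E^* )\le \Psi_p(v_p^*,E^* )$ for all $p\in P$ and all $v_p\in S_p$; (2) $\Psi_c(V_c,E^* )\le \Psi_c(V_c^*,E^* )$ for all $c\in C$ and all $V_c\in S_c$; (3) $\Psi_M(E,V^* )\le \Psi_M(E^*,V^* )$ for all $E\in S_M$, where $V^*$ collects the electricity trading vectors $V_p^*$ (the electricity components of $v_p^*$), $p\in P$, and $V_c^*$, $c\in C$.
   Context: Model. $P$ (producers) and $C$ (consumers) are finite nonempty sets, $L$ is a finite set of fuels, and $R^{p,l}$ is the finite set of power plants of producer $p$ running on fuel $l$. $T_1,\dots,T_{T'}$ are delivery times, $J=\{1,\dots,T'\}$; for $j\in J$ the finite set $I_j$ indexes the trading times $t_i$ for delivery at $T_j$; $N=\sum_{j\in J}|I_j|$. $\hat r\in\mathbb R$ is an interest rate. $\Pi(t_i,T_j)$ (electricity), $G_l(t_i,T_j)$ (fuel $l$) and $G_{em}(t_i,T_j)$ (emissions) are forward prices: real random variables with finite second moments on a probability space with measure $\mathbb P$. $\Pi\in\mathbb R^N$, $G\in\mathbb R^{N|L|}$, $G_{em}\in\mathbb R^N$ denote the vectors of all these prices, each entry with delivery time $T_j$ multiplied by $e^{-\hat rT_j}$. $D(T_j)\in\mathbb R$ is the (known) demand, and $p_c\in[0,1]$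 with $\sum_{c\in C}p_c=1$. Producer $p$ chooses $v_p=(V_p,F_p,O_p,W_p)$, consisting of real numbers $V_p(t_i,T_j)$, $F_{p,l}(t_i,T_j)$, $O_p(t_i,T_j)$, $W_{p,l,r}(T_j)$ ($j\in J$, $i\in I_j$, $l\in L$, $r\in R^{p,l}$). The feasible set $S_p$ consists of all $v_p$ satisfying the equalities $-\sum_{i\in I_j}V_p(t_i,T_j)=\sum_{l}\sum_{r\in R^{p,l}}W_{p,l,r}(T_j)$ for all $j$; $\sum_{r\in R^{p,l}}c^{p,l,r}W_{p,l,r}(T_j)=\sum_{i\in I_j}F_{p,l}(t_i,T_j)$ for all $j,l$; $\sum_j\sum_{i\in I_j}O_p(t_i,T_j)=\sum_j\sum_l\sum_{r\in R^{p,l}}g^lW_{p,l,r}(T_j)$; and the inequalities $\triangle\overline W_{min}^{p,l,r}\le W_{p,l,r}(T_{j+1})-W_{p,l,r}(T_j)\le\triangle\overline W_{max}^{p,l,r}$ for $j\in\{1,\dots,T'-1\}$; $0\le W_{p,l,r}(T_j)\le\overline W_{max}^{p,l,r}$; $|F_{p,l}(t_i,T_j)|\le F_{trade}$; $|O_p(t_i,T_j)|\le F_{trade}$; $|V_p(t_i,T_j)|\le V_{trade}$. Here $c^{p,l,r}>0$, $g^l>0$, the ramping bounds and $\overline W_{max}^{p,l,r}$ are given real constants, and $F_{trade},V_{trade}>0$ are given (large) constants. Consumer $c$ chooses $V_c\in\mathbb R^N$ with entries $V_c(t_i,T_j)$; $S_c$ is the set of $V_c$ with $\sum_{i\in I_j}V_c(t_i,T_j)=p_cD(T_j)$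 for all $j$ and $|V_c(t_i,T_j)|\le V_{trade}$ for all $i,j$. $E\in\mathbb R^N$ denotes the vector of expected discounted electricity prices (entries $E(t_i,T_j)=e^{-\hat rT_j}\times$ expected value of $\Pi(t_i,T_j)$), chosen by a hypothetical market agent; choosing $E$ shifts the mean of $\Pi$ but leaves all covariances unchanged. Let $\hat Q$ be the covariance matrix under $\mathbb P$ of $(\Pi,G,G_{em})$ and $\hat Q_1$ that of $\Pi$. With $v_p'=(V_p,F_p,O_p)$ and risk preferences $\lambda_p,\lambda_c>0$, $$\Psi_p(v_p,E)=-E^\top V_p-\mathbb E^{\mathbb P}[G]^\top F_p-\mathbb E^{\mathbb P}[G_{em}]^\top O_p-\tfrac{\lambda_p}2 v_p'^\top\hat Qv_p',\qquad \Psi_c(V_c,E)=-E^\top V_c-\tfrac{\lambda_c}2V_c^\top\hat Q_1V_c,$$ $$\Psi_M(E,V)=E^\top\Big(\sum_{c\in C}V_c+\sum_{p\in P}V_p\Big),\qquad S_M=\{E\in\mathbb R^N: |e^{\hat rT_j}E(t_i,T_j)|\le\Pi_{max}\ \forall j\in J,i\in I_j\},$$ with a given (large) constant $\Pi_{max}>0$. Assumption (A): for every $p\in P$ there is $v_p$ satisfying all equality constraints of $S_p$ and all its inequality constraints strictly; for every $c\in C$ there is $V_c$ satisfying the equality constraints of $S_c$ and its inequality constraints strictly; and these can be chosen such that $\sum_{c}V_c(t_i,T_j)+\sum_pV_p(t_i,T_j)=0$ for all $j\in J$, $i\in I_j$. *)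

(* Defs.v *)
From HB Require Import structures.
From mathcomp Require Import all_boot all_order all_algebra.
From mathcomp Require Import all_classical all_reals all_analysis.

Set Implicit Arguments.
Unset Strict Implicit.
Unset Printing Implicit Defensive.

Import Order.TTheory GRing.Theory Num.Theory.
Import numFieldNormedType.Exports.

Local Open Scope ring_scope.

(* Vectors and matrices are indexed directly by finite types. *)
Definition dot (R : realType) (A : finType) (u v : A -> R) : R :=
  \sum_a u a * v a.

Definition quadratic_form (R : realType) (A : finType)
    (Q : A -> A -> R) (v : A -> R) : R :=
  \sum_a \sum_b v a * Q a b * v b.

Definition covariance_matrix (R : realType) (d : measure_display)
    (Omega : measurableType d) (Pr : probability Omega R)
    (A : finType) (X : A -> Omega -> R) : A -> A -> R :=
  fun a b => fine (covariance Pr (X a) (X b)).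

(* {j & trading j} is the set of pairs (t_i, T_j) with i in I_j; delivery
   periods are numbered from 0. *)
Record market (R : realType) (d : measure_display) (Omega : measurableType d)
    (Pr : probability Omega R) := Market {
  producer : finType;
  consumer : finType;
  fuel : finType;
  plant : producer -> fuel -> finType;
  n_delivery : nat;
  trading : 'I_n_delivery -> finType;
  delivery_time : 'I_n_delivery -> R;
  interest : R;
  electricity : {j : 'I_n_delivery & trading j} -> {RV Pr >-> R};
  fuel_price : {j : 'I_n_delivery & trading j} -> fuel -> {RV Pr >-> R};
  emission : {j : 'I_n_delivery & trading j} -> {RV Pr >-> R};
  demand : 'I_n_delivery -> R;
  share : consumer -> R;
  (* c^{p,l,r} *)
  fuel_rate : forall p l, plant p l -> R;
  (* g^l *)
  emission_rate : fuel -> R;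
  ramp_min : forall p l, plant p l -> R;
  ramp_max : forall p l, plant p l -> R;
  capacity : forall p l, plant p l -> R;
  F_trade : R;
  V_trade : R;
  Pi_max : R;
  producer_risk : producer -> R;
  consumer_risk : consumer -> R;
  producer_nonempty : (0 < #|producer|)%N;
  consumer_nonempty : (0 < #|consumer|)%N;
  electricity_L2 : forall a, (electricity a : Omega -> R) \in Lfun Pr 2%:E;
  fuel_price_L2 : forall a l, (fuel_price a l : Omega -> R) \in Lfun Pr 2%:E;
  emission_L2 : forall a, (emission a : Omega -> R) \in Lfun Pr 2%:E;
  share_ge0 : forall c, 0 <= share c;
  share_le1 : forall c, share c <= 1;
  share_sum1 : \sum_c share c = 1;
  fuel_rate_gt0 : forall p l (r : plant p l), 0 < fuel_rate r;
  emission_rate_gt0 : forall l, 0 < emission_rate l;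
  F_trade_gt0 : 0 < F_trade;
  V_trade_gt0 : 0 < V_trade;
  Pi_max_gt0 : 0 < Pi_max;
  producer_risk_gt0 : forall p, 0 < producer_risk p;
  consumer_risk_gt0 : forall c, 0 < consumer_risk c }.

Section Model.
Context {R : realType} {d : measure_display} {Omega : measurableType d}
  {Pr : probability Omega R}.
Variable M : market Pr.

Definition trade : finType := {j : 'I_(n_delivery M) & trading j}.

Definition at_delivery (j : 'I_(n_delivery M)) (i : trading j) : trade :=
  Tagged (fun j => trading j) i.

Definition fuel_trade : finType := (trade * fuel M)%type.

(* Index set of (Pi, G, G_em) and of v' = (V, F, O). *)
Definition instrument : finType := (trade + fuel_trade + trade)%type.

Definition discount (a : trade) : R :=
  expR (- (interest M * delivery_time (tag a))).

Definition Pi_vec (a : trade) : Omega -> R :=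
  discount a \o* (electricity a : Omega -> R).

Definition G_vec (b : fuel_trade) : Omega -> R :=
  discount b.1 \o* (fuel_price b.1 b.2 : Omega -> R).

Definition Gem_vec (a : trade) : Omega -> R :=
  discount a \o* (emission a : Omega -> R).

Definition price_vec (x : instrument) : Omega -> R :=
  match x with
  | inl (inl a) => Pi_vec a
  | inl (inr b) => G_vec b
  | inr a => Gem_vec a
  end.

Definition Qhat : instrument -> instrument -> R :=
  covariance_matrix Pr price_vec.

Definition Qhat1 : trade -> trade -> R := covariance_matrix Pr Pi_vec.

Definition mean_G (b : fuel_trade) : R := fine ('E_Pr[G_vec b])%E.

Definition mean_Gem (a : trade) : R := fine ('E_Pr[Gem_vec a])%E.

Record producer_strategy (p : producer M) := ProducerStrategy {
  Vp : trade -> R;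
  Fp : fuel_trade -> R;
  Op : trade -> R;
  Wp : forall l : fuel M, plant p l -> 'I_(n_delivery M) -> R }.

Section Producer.
Variable p : producer M.

Definition portfolio (v : producer_strategy p) (x : instrument) : R :=
  match x with
  | inl (inl a) => Vp v a
  | inl (inr b) => Fp v b
  | inr a => Op v a
  end.

Definition producer_equalities (v : producer_strategy p) : Prop :=
  [/\ forall j : 'I_(n_delivery M),
        - \sum_(i : trading j) Vp v (at_delivery i)
        = \sum_(l : fuel M) \sum_(r : plant p l) Wp v r j,
      forall (j : 'I_(n_delivery M)) (l : fuel M),
        \sum_(r : plant p l) fuel_rate r * Wp v r j
        = \sum_(i : trading j) Fp v (at_delivery i, l)
    & \sum_(j : 'I_(n_delivery M)) \sum_(i : trading j) Op v (at_delivery i)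
      = \sum_(j : 'I_(n_delivery M)) \sum_(l : fuel M) \sum_(r : plant p l)
          emission_rate l * Wp v r j].

(* To be used with cmp := <=%R, and with cmp := <%R for strict feasibility. *)
Definition producer_inequalities (cmp : rel R) (v : producer_strategy p)
    : Prop :=
  [/\ forall (l : fuel M) (r : plant p l) (j j' : 'I_(n_delivery M)),
        j' = j.+1 :> nat ->
        cmp (ramp_min r) (Wp v r j' - Wp v r j)
        /\ cmp (Wp v r j' - Wp v r j) (ramp_max r),
      forall (l : fuel M) (r : plant p l) (j : 'I_(n_delivery M)),
        cmp 0 (Wp v r j) /\ cmp (Wp v r j) (capacity r),
      forall b : fuel_trade, cmp `|Fp v b| (F_trade M),
      forall a : trade, cmp `|Op v a| (F_trade M)
    & forall a : trade, cmp `|Vp v a| (V_trade M)].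

Definition S_p (v : producer_strategy p) : Prop :=
  producer_equalities v /\ producer_inequalities <=%R v.

Definition Psi_p (v : producer_strategy p) (E : trade -> R) : R :=
  - dot E (Vp v) - dot mean_G (Fp v) - dot mean_Gem (Op v)
  - producer_risk p / 2 * quadratic_form Qhat (portfolio v).

End Producer.

Section Consumer.
Variable c : consumer M.

Definition consumer_equalities (V : trade -> R) : Prop :=
  forall j : 'I_(n_delivery M),
    \sum_(i : trading j) V (at_delivery i) = share c * demand j.

Definition consumer_inequalities (cmp : rel R) (V : trade -> R) : Prop :=
  forall a : trade, cmp `|V a| (V_trade M).

Definition S_c (V : trade -> R) : Prop :=
  consumer_equalities V /\ consumer_inequalities <=%R V.

Definition Psi_c (V E : trade -> R) : R :=
  - dot E V - consumer_risk c / 2 * quadratic_form Qhat1 V.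

End Consumer.

Definition net_trade (v : forall p : producer M, producer_strategy p)
    (V : consumer M -> trade -> R) (a : trade) : R :=
  \sum_c V c a + \sum_p Vp (v p) a.

Definition S_M (E : trade -> R) : Prop :=
  forall a : trade,
    `|expR (interest M * delivery_time (tag a)) * E a| <= Pi_max M.

Definition Psi_M (E : trade -> R)
    (v : forall p : producer M, producer_strategy p)
    (V : consumer M -> trade -> R) : R :=
  dot E (net_trade v V).

Definition strictly_feasible : Prop :=
  exists (v : forall p : producer M, producer_strategy p)
         (V : consumer M -> trade -> R),
    [/\ forall p, producer_equalities (v p)
                  /\ producer_inequalities <%R (v p),
        forall c, consumer_equalities c (V c)
                  /\ consumer_inequalities <%R (V c)
      & forall a : trade, net_trade v V a = 0].

End Model.

(* Main.v *)
Require Import Defs.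
From HB Require Import structures.
From mathcomp Require Import all_boot all_order all_algebra.
From mathcomp Require Import all_classical all_reals all_analysis.
From mathcomp Require Import ring lra.

Set Implicit Arguments.
Unset Strict Implicit.
Unset Printing Implicit Defensive.

Import Order.TTheory GRing.Theory Num.Theory.
Import numFieldNormedType.Exports.

Local Open Scope classical_set_scope.
Local Open Scope ring_scope.

(** The equilibria of this game are the saddle points of one function.
    Add up the payoffs of all producers and consumers: the sum has the form

      L(x, E) = f(x) - E . net(x),

    where x is the profile of all trading and production decisions, f collects
    the terms that do not involve the electricity price, and net(x) is the
    aggregate electricity position.  Each agent enters L through its own
    payoff only, and the market agent's payoff is E . net(x) = f(x) - L(x, E).
    Hence a profile x maximising L(., E) over the feasible set, paired with a
    price E minimising L(x, .) over the price box, is an equilibrium: let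
    one agent deviate at a time.

    A saddle point exists because L is concave in x (a covariance matrix is
    positive semidefinite, [quadratic_form_covariance_ge0]), affine in E, and
    both strategy sets are compact and convex.
    Adding (e/2)|E|^2 to L makes the minimising price unique, coordinatewise
    explicit (the truncation [clamp] of net(x)/e to the box) and continuous in
    x.  Let x maximise the resulting lower envelope of L.  Moving from x
    towards a competitor x' by a step t cannot raise the envelope, so concavity
    bounds the perturbed function at x', taken at the price that is optimal for
    the moved point, by the maximum.  Letting t tend to 0 turns this into the
    saddle inequality for the perturbed function ([approximate_saddle]).  The
    perturbation is at most a multiple of e on the box, so a cluster point as e
    tends to 0 is a saddle point of L ([saddle_point]).

    The feasibility assumption provides a feasible profile, so that the
    compact set over which the envelope is maximised is nonempty. *)

(** * Continuous affine and concave functions, closed convex sets *)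

Lemma continuous_sum_fct {R : realType} {X : topologicalType} (I : finType)
    (g : I -> X -> R) :
  (forall i, continuous (g i)) -> continuous (fun x => \sum_i g i x).
Proof.
move=> gc x; apply: (@cvg_big R _ +%R 0 _ _ _ (nbhs x) _ g (g^~ x)) => [|i _].
  exact: add_continuous.
exact: gc.
Qed.

Section AffineConcave.
Context {R : realType} {X : normedModType R}.

Definition segment_point (t : R) (x y : X) : X := x + t *: (y - x).

(** Continuity is part of [affine], [concave] and (as closedness) of
    [convex_closed], so that one traversal of the model's formulas settles both
    the topology and the convexity. *)
Definition affine (g : X -> R) : Prop :=
  continuous g /\
  forall t x y, g (segment_point t x y) = g x + t * (g y - g x).

Definition concave (g : X -> R) : Prop :=
  continuous g /\
  forall t x y, 0 <= t <= 1 ->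
    g x + t * (g y - g x) <= g (segment_point t x y).

Definition convex_closed (S : set X) : Prop :=
  closed S /\
  forall t x y, 0 <= t <= 1 -> S x -> S y -> S (segment_point t x y).

Lemma affine_cst c : affine (fun=> c).
Proof. by split=> [x|t x y]; [exact: cvg_cst|rewrite subrr mulr0 addr0]. Qed.

Lemma affineD g h : affine g -> affine h -> affine (fun x => g x + h x).
Proof.
move=> [gc ga] [hc ha]; split=> [x|t x y]; first exact: cvgD (gc x) (hc x).
by rewrite ga ha; ring.
Qed.

Lemma affineZ c g : affine g -> affine (fun x => c * g x).
Proof.
move=> [gc ga]; split=> [x|t x y]; last by rewrite ga; ring.
by apply: cvgM; [exact: cvg_cst|exact: gc].
Qed.

Lemma affineN g : affine g -> affine (fun x => - g x).
Proof.
by move=> [gc ga]; split=> [x|t x y]; [exact: cvgN (gc x)|rewrite ga; ring].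
Qed.

Lemma affine_sum (I : finType) (g : I -> X -> R) :
  (forall i, affine (g i)) -> affine (fun x => \sum_i g i x).
Proof.
move=> ga; split=> [|t x y].
  by apply: continuous_sum_fct => i; exact: (ga i).1.
rewrite -sumrB mulr_sumr -big_split; apply: eq_bigr => i _.
exact: (ga i).2.
Qed.

Lemma concave_affine g : affine g -> concave g.
Proof. by move=> [gc ga]; split=> // t x y _; rewrite ga. Qed.

Lemma concaveD g h : concave g -> concave h -> concave (fun x => g x + h x).
Proof.
move=> [gc ga] [hc ha]; split=> [x|t x y t01]; first exact: cvgD (gc x) (hc x).
by have := lerD (ga t x y t01) (ha t x y t01); lra.
Qed.

Lemma concave_sum (I : finType) (g : I -> X -> R) :
  (forall i, concave (g i)) -> concave (fun x => \sum_i g i x).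
Proof.
move=> ga; split=> [|t x y t01].
  by apply: continuous_sum_fct => i; exact: (ga i).1.
rewrite -sumrB mulr_sumr -big_split; apply: ler_sum => i _.
exact: (ga i).2.
Qed.

(** The defect of a quadratic form along a segment is a multiple of its value
    on the direction; this is why a nonnegative form is convex. *)
Lemma quadratic_form_segment (A : finType) (Q : A -> A -> R) (u v : A -> R) t :
  quadratic_form Q (fun a => u a + t * (v a - u a)) =
  quadratic_form Q u + t * (quadratic_form Q v - quadratic_form Q u)
  - t * (1 - t) * quadratic_form Q (fun a => v a - u a).
Proof.
rewrite /quadratic_form -sumrB !mulr_sumr -big_split -sumrB.
apply: eq_bigr => a _; rewrite -sumrB !mulr_sumr -big_split -sumrB.
by apply: eq_bigr => b _ /=; ring.
Qed.

Lemma concave_quadratic (A : finType) (Q : A -> A -> R) (k : R)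
    (g : A -> X -> R) :
  (forall u, 0 <= quadratic_form Q u) -> 0 <= k -> (forall a, affine (g a)) ->
  concave (fun x => - (k * quadratic_form Q (fun a => g a x))).
Proof.
move=> Qge0 k0 ga; split=> [x|t x y /andP[t0 t1]].
  apply: cvgN; apply: cvgM; first exact: cvg_cst.
  apply: continuous_sum_fct => a; apply: continuous_sum_fct => b z.
  apply: cvgM; last exact: (ga b).1.
  by apply: cvgM; [exact: (ga a).1|exact: cvg_cst].
have -> : (fun a => g a (segment_point t x y)) =
    (fun a => g a x + t * (g a y - g a x)).
  by apply/funext => a; rewrite (ga a).2.
rewrite quadratic_form_segment.
have : 0 <= k * (t * (1 - t) * quadratic_form Q (fun a => g a y - g a x)).
  by rewrite !mulr_ge0 ?subr_ge0.
lra.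
Qed.

Lemma convex_closed_ler g h : affine g -> affine h ->
  convex_closed [set x | g x <= h x].
Proof.
move=> [gc ga] [hc ha]; split=> [|t x y /andP[t0 t1] /= gx gy].
  have -> : [set x | g x <= h x] = (fun x => h x - g x) @^-1` [set z | 0 <= z].
    by apply/seteqP; split=> x /=; rewrite subr_ge0.
  apply: preimage_closed; last exact: closed_ge.
  by move=> x _; apply: cvgB; [exact: hc|exact: gc].
by rewrite ga ha; nra.
Qed.

Lemma convex_closed_and (P1 P2 : X -> Prop) :
  convex_closed [set x | P1 x] -> convex_closed [set x | P2 x] ->
  convex_closed [set x | P1 x /\ P2 x].
Proof.
move=> [c1 a1] [c2 a2]; split; first exact: closedI.
by move=> t x y t01 [x1 x2] [y1 y2]; split; [exact: a1|exact: a2].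
Qed.

Lemma convex_closed_and3 (P1 P2 P3 : X -> Prop) :
  convex_closed [set x | P1 x] -> convex_closed [set x | P2 x] ->
  convex_closed [set x | P3 x] ->
  convex_closed [set x | [/\ P1 x, P2 x & P3 x]].
Proof.
move=> c1 c2 c3.
have -> : [set x | [/\ P1 x, P2 x & P3 x]] = [set x | P1 x /\ P2 x /\ P3 x].
  by apply/seteqP; split=> x /=; [case|case=> ? []].
by do 2?[apply: convex_closed_and => //].
Qed.

Lemma convex_closed_and5 (P1 P2 P3 P4 P5 : X -> Prop) :
  convex_closed [set x | P1 x] -> convex_closed [set x | P2 x] ->
  convex_closed [set x | P3 x] -> convex_closed [set x | P4 x] ->
  convex_closed [set x | P5 x] ->
  convex_closed [set x | [/\ P1 x, P2 x, P3 x, P4 x & P5 x]].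
Proof.
move=> c1 c2 c3 c4 c5.
have -> : [set x | [/\ P1 x, P2 x, P3 x, P4 x & P5 x]] =
    [set x | [/\ P1 x, P2 x & P3 x] /\ P4 x /\ P5 x].
  by apply/seteqP; split=> x /=; [case|case=> -[? ? ?] []].
apply: convex_closed_and; first exact: convex_closed_and3.
exact: convex_closed_and.
Qed.

Lemma convex_closed_forall (I : Type) (S : I -> set X) :
  (forall i, convex_closed (S i)) -> convex_closed [set x | forall i, S i x].
Proof.
move=> Sc; split=> [|t x y t01 Sx Sy i]; last exact: (Sc i).2.
have -> : [set x | forall i, S i x] = \bigcap_i S i.
  by apply/seteqP; split=> x Sx i; [move=> _|]; exact: Sx.
by apply: closed_bigI => i _; exact: (Sc i).1.
Qed.

Lemma convex_closed_eq g h : affine g -> affine h ->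
  convex_closed [set x | g x = h x].
Proof.
move=> ga ha.
have -> : [set x | g x = h x] = [set x | g x <= h x /\ h x <= g x].
  apply/seteqP; split=> x /= => [->|[gh hg]]; first by rewrite !lexx.
  by apply/eqP; rewrite eq_le gh.
by apply: convex_closed_and; exact: convex_closed_ler.
Qed.

Lemma convex_closed_norm g c : affine g ->
  convex_closed [set x | `|g x| <= c].
Proof.
move=> ga.
have -> : [set x | `|g x| <= c] = [set x | - c <= g x /\ g x <= c].
  by apply/seteqP; split=> x /=; rewrite ler_norml => /andP.
by apply: convex_closed_and; apply: convex_closed_ler => //; exact: affine_cst.
Qed.

End AffineConcave.

(** * The penalised best price *)

Section Clamp.
Context {R : realType}.
Variables (b e : R).
Hypotheses (b0 : 0 <= b) (e0 : 0 < e).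

(** The parabola z |-> e/2 z^2 - z a has its vertex at a/e, so its minimiser on
    the interval [-b, b] is the vertex truncated to that interval. *)
Definition clamp (a : R) : R := Num.max (- b) (Num.min b (a / e)).

Lemma clamp_bound a : `|clamp a| <= b.
Proof.
rewrite ler_norml /clamp le_max lexx /= ge_max ge_min lexx /= andbT.
by rewrite (le_trans _ b0) ?oppr_le0.
Qed.

Lemma clamp_continuous : continuous clamp.
Proof.
move=> a.
apply: (@continuous_max R R (cst (- b)) (fun a => Num.min b (a / e)) a).
  exact: cvg_cst.
apply: (@continuous_min R R (cst b) (fun a => a / e) a); first exact: cvg_cst.
by apply: cvgM; [exact: cvg_id|exact: cvg_cst].
Qed.

Lemma clamp_min a z : `|z| <= b ->
  e / 2 * clamp a ^+ 2 - clamp a * a <= e / 2 * z ^+ 2 - z * a.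
Proof.
rewrite ler_norml => /andP[bz zb].
rewrite -subr_ge0.
(* Factor out the distance to the minimiser; the other factor has its sign. *)
have -> : e / 2 * z ^+ 2 - z * a - (e / 2 * clamp a ^+ 2 - clamp a * a) =
  (z - clamp a) * (e * (z + clamp a) / 2 - a) by ring.
have nbb : - b <= b by rewrite (le_trans _ b0) ?oppr_le0.
rewrite /clamp; case: (leP b (a / e)) => [ba|ab].
  rewrite max_r //; rewrite ler_pdivlMr // in ba.
  have : 0 <= e * (b - z) by rewrite mulr_ge0 ?subr_ge0 // ltW.
  by move=> ebz; rewrite mulr_le0 // ?subr_le0 //; lra.
case: (leP (- b) (a / e)) => [ba|ab'].
  have -> : (z - a / e) * (e * (z + a / e) / 2 - a) =
      e / 2 * (z - a / e) ^+ 2 by field; rewrite gt_eqF.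
  by rewrite mulr_ge0 ?sqr_ge0 ?divr_ge0 ?ltW.
rewrite ltr_pdivrMr // in ab'.
have : 0 <= e * (z - - b) by rewrite mulr_ge0 ?subr_ge0 // ltW.
by move=> ebz; rewrite mulr_ge0 // ?subr_ge0 //; lra.
Qed.

End Clamp.

(** * Saddle points of concave-affine functions *)

Lemma ler_right_limit {R : realType} (g : R -> R) (c : R) :
  {for 0, continuous g} -> (forall t, 0 < t <= 1 -> g t <= c) -> g 0 <= c.
Proof.
move=> gc gle; rewrite leNgt; apply/negP => cg.
have gc0 : g t @[t --> 0^'+] --> g 0 by exact/cvg_at_right_filter/gc.
near (0 : R)^'+ => t.
have : g t <= c.
  apply: gle; apply/andP; split; first by near: t; exact: nbhs_right_gt.
  by near: t; exact: nbhs_right_le.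
by rewrite leNgt => /negP; apply; near: t; exact: cvgr_gt gc0 _ cg.
Unshelve. all: by end_near. Qed.

Section SaddlePoint.
Context {R : realType} {X : normedModType R} {J : finType}.
Variables (K : set X) (f : X -> R) (A : X -> J -> R) (b : J -> R).
Hypotheses (K0 : K !=set0) (Kcompact : compact K) (Kconvex : convex_closed K).
Hypotheses (fconcave : concave f) (Aaffine : forall j, affine (A^~ j)).
Hypothesis b0 : forall j, 0 <= b j.

Definition in_box (E : J -> R) : Prop := forall j, `|E j| <= b j.

(** The term e/2 |E|^2 makes the minimising price a continuous function of x, so
    the minimum over prices attains its maximum on [K] at some x, and there the
    minimising price is a saddle price of the penalised function.  The
    conclusion concerns the unpenalised one: the error bounds the penalty on the
    box. *)
Lemma approximate_saddle (e : R) : 0 < e ->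
  exists2 x, K x & exists2 E, in_box E & forall x' E', K x' -> in_box E' ->
    f x' - dot E (A x') <= f x - dot E' (A x) + e * \sum_j b j ^+ 2.
Proof.
move=> e0.
pose E x j := clamp (b j) e (A x j).
pose L x E' := f x + \sum_j (e / 2 * E' j ^+ 2 - E' j * A x j).
have Ebox x : in_box (E x) by move=> j; exact: clamp_bound.
have Emin x E' : in_box E' -> L x (E x) <= L x E'.
  by move=> E'b; rewrite lerD2l; apply: ler_sum => j _; exact: clamp_min.
have Ec j : continuous (fun x => E x j).
  move=> x; apply: (continuous_comp (f := A^~ j) (g := clamp (b j) e)).
    exact: (Aaffine j).1.
  exact: clamp_continuous.
have Lc : continuous (fun x => L x (E x)).
  move=> x; apply: cvgD; first exact: fconcave.1.
  apply: continuous_sum_fct => j z; apply: cvgB.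
    apply: cvgM; first exact: cvg_cst.
    by rewrite expr2; under eq_fun do rewrite expr2; apply: cvgM; exact: Ec.
  by apply: cvgM; [exact: Ec|exact: (Aaffine j).1].
have [x /set_mem Kx xmax] :=
  compact_EVT_max K0 Kcompact (continuous_subspaceT Lc).
(* Compare the maximum with the points p t of the segment from x to x'. *)
have saddle x' : K x' -> L x' (E x) <= L x (E x).
  move=> Kx'.
  pose p t := segment_point t x x'.
  have pc : continuous p.
    move=> t; apply: cvgD; first exact: cvg_cst.
    by apply: cvgZ; [exact: cvg_id|exact: cvg_cst].
  have p0 : p 0 = x by rewrite /p /segment_point scale0r addr0.
  rewrite -[X in L x' (E X)]p0.
  apply: (@ler_right_limit _ (fun t => L x' (E (p t)))).
    apply: cvgD; first exact: cvg_cst.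
    apply: (@continuous_sum_fct _ R) => j t.
    have Epc : {for t, continuous (fun s => E (p s) j)}.
      by apply: (continuous_comp (f := p) (g := fun y => E y j));
        [exact: pc|exact: Ec].
    apply: cvgB.
      apply: cvgM; first exact: cvg_cst.
      by rewrite expr2; under eq_fun do rewrite expr2; apply: cvgM; exact: Epc.
    by apply: cvgM; [exact: Epc|exact: cvg_cst].
  move=> t /andP[t0 t1].
  have t01 : 0 <= t <= 1 by rewrite ltW.
  have Kp : K (p t) by exact: Kconvex.2.
  have := xmax (p t) (mem_set Kp).
  have := Emin x (E (p t)) (Ebox _).
  have : L x (E (p t)) + t * (L x' (E (p t)) - L x (E (p t))) <=
         L (p t) (E (p t)).
    set e' := E (p t).
    have -> : L (p t) e' = f (p t) + (\sum_j (e / 2 * e' j ^+ 2 - e' j * A x j)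
        + t * (\sum_j (e / 2 * e' j ^+ 2 - e' j * A x' j)
               - \sum_j (e / 2 * e' j ^+ 2 - e' j * A x j))).
      congr (_ + _); rewrite -sumrB mulr_sumr -big_split; apply: eq_bigr => j _.
      by rewrite /p (Aaffine j).2 /=; ring.
    have := fconcave.2 t x x' t01; rewrite /L -/(p t); lra.
  move: (L x (E (p t))) (L x' _) (L (p t) _) (L x (E x)) => u v w z uv zu wz.
  (* u + t (v - u) <= w <= z <= u with 0 < t <= 1 forces v <= z. *)
  have tuz : 0 <= (1 - t) * (u - z) by rewrite mulr_ge0 ?subr_ge0.
  have : t * (v - u) <= t * (z - u) by lra.
  rewrite ler_pM2l //; lra.
exists x => //; exists (E x) => // x' E' Kx' E'b.
have := le_trans (saddle _ Kx') (Emin _ _ E'b).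
rewrite /L /dot !sumrB.
have : 0 <= \sum_j e / 2 * E x j ^+ 2.
  by apply: sumr_ge0 => j _; rewrite mulr_ge0 ?sqr_ge0 // divr_ge0 ?ltW.
have : \sum_j e / 2 * E' j ^+ 2 <= e * \sum_j b j ^+ 2.
  rewrite mulr_sumr; apply: ler_sum => j _.
  have : E' j ^+ 2 <= b j ^+ 2.
    by rewrite -real_normK ?num_real // lerXn2r ?nnegrE.
  have := sqr_ge0 (b j); move: (E' j ^+ 2) (b j ^+ 2) => u w w0 uw.
  have : e / 2 * u <= e / 2 * w by rewrite ler_wpM2l // divr_ge0 // ltW.
  have : 0 <= e * w by rewrite mulr_ge0 // ltW.
  lra.
lra.
Qed.

(** The saddle gap against fixed deviations is continuous in the candidate
    (x, E); along approximate saddles with e = 1/(k+1) it is bounded above by a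
    null sequence, hence it is nonpositive at any cluster point, and compactness
    gives one that serves all deviations at once. *)
Theorem saddle_point :
  exists2 x, K x & exists2 E, in_box E & forall x' E', K x' -> in_box E' ->
    f x' - dot E (A x') <= f x - dot E' (A x).
Proof.
pose n := #|J|.
(* The price vectors are stored as row vectors to use the compactness of boxes
   there. *)
pose fam (E : 'rV[R]_n) (j : J) := E 0 (enum_rank j).
pose I (i : 'I_n) := `[- b (enum_val i), b (enum_val i)]%classic.
pose B := [set E : 'rV[R]_n | forall i, I i (E 0 i)].
have Bbox E : B E -> in_box (fam E).
  move=> BE j; have := BE (enum_rank j).
  by rewrite /I /= in_itv /= enum_rankK -ler_norml.
have KBcompact : compact (K `*` B).
  apply: compact_setX => //.
  by apply: (@rV_compact R^o _ I) => i; exact: segment_compact.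
pose C := \sum_j b j ^+ 2.
pose gap (x' : X) (E' : J -> R) (z : X * 'rV[R]_n) :=
  f x' - dot (fam z.2) (A x') - (f z.1 - dot E' (A z.1)).
have seq_ex k : exists z : X * 'rV[R]_n, (K `*` B) z /\
    forall x' E', K x' -> in_box E' -> gap x' E' z <= k.+1%:R^-1 * C.
  have [|x Kx [E Eb xE]] := @approximate_saddle (k.+1%:R^-1).
    by rewrite invr_gt0.
  exists (x, \row_i E (enum_val i)); split.
    by split=> //= i; rewrite /I /= in_itv /= mxE -ler_norml.
  move=> x' E' Kx' E'b; have := xE x' E' Kx' E'b; rewrite /gap /=.
  have -> : fam (\row_i E (enum_val i)) = E.
    by apply/funext => j; rewrite /fam mxE enum_rankK.
  by rewrite -/C; move: (_ * C) => u; lra.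
have [z zP] := choice seq_ex.
have [|[x E] [[/= Kx BE] clus]] := KBcompact (z @ \oo).
  by exists 0%N => // k _; exact: (zP k).1.
exists x => //; exists (fam E); first exact: Bbox.
move=> x' E' Kx' E'b.
suff : gap x' E' (x, E) <= 0 by rewrite /gap /= subr_le0.
rewrite leNgt; apply/negP => gap0; set g0 := gap x' E' (x, E) in gap0.
have gapc : continuous (gap x' E').
  move=> y; apply: cvgB; first (apply: cvgB; first exact: cvg_cst).
    apply: (@continuous_sum_fct _ (X * 'rV[R]_n)%type) => j w.
    apply: cvgM; last exact: cvg_cst.
    apply: (continuous_comp (f := snd) (g := fam^~ j)); first exact: cvg_snd.
    exact: coord_continuous.
  apply: cvgB.
    apply: (continuous_comp (f := fst) (g := f)); first exact: cvg_fst.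
    exact: fconcave.1.
  apply: (@continuous_sum_fct _ (X * 'rV[R]_n)%type) => j w.
  apply: cvgM; first exact: cvg_cst.
  apply: (continuous_comp (f := fst) (g := A^~ j)); first exact: cvg_fst.
  exact: (Aaffine j).1.
have [N _ Ng] : \forall k \near \oo, k.+1%:R^-1 * C < g0 / 2.
  have : (k.+1%:R^-1 * C : R) @[k --> \oo] --> (0 * C : R).
    by apply: cvgM; [exact: cvg_harmonic|exact: cvg_cst].
  move=> /cvgr_lt; rewrite mul0r; apply; lra.
have nb : nbhs (x, E) [set y | g0 / 2 < gap x' E' y].
  by apply: (cvgr_gt _ (gapc (x, E))); rewrite -/g0; lra.
have [|y [[k Nk <-] /=]] := clus [set z k | k in [set k | (N <= k)%N]] _ _ nb.
  by exists N => // k Nk; exists k.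
by have /= := Ng k Nk; have := (zP k).2 x' E' Kx' E'b; move: (_ * C) => u; lra.
Qed.

End SaddlePoint.

(** * Covariance matrices are positive semidefinite *)

Section CovarianceMatrix.
Context {R : realType} {d : measure_display} {Omega : measurableType d}
  (Pr : probability Omega R).

Lemma fine_covariance_suml (A : finType) (Y : A -> Omega -> R)
    (Z : Omega -> R) :
  (forall a, Y a \in Lfun Pr 2%:E) -> Z \in Lfun Pr 2%:E ->
  fine (covariance Pr (\sum_a Y a) Z) = \sum_a fine (covariance Pr (Y a) Z).
Proof.
move=> Y2 Z2.
have Pfin : Pr setT \is a fin_num := fin_num_measure Pr _ measurableT.
have cov_fin V : V \in Lfun Pr 2%:E -> covariance Pr V Z \is a fin_num.
  by move=> V2; rewrite covariance_fin_num ?Lfun2_mul_Lfun1 // Lfun_subset12.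
elim: (index_enum A) => [|a s IH].
  by rewrite !big_nil (_ : 0 = cst 0) // covariance_cst_l.
have S2 : \sum_(i <- s) Y i \in Lfun Pr 2%:E.
  apply: rpred_sum => [|le12 i _]; last exact: Y2.
  by rewrite lee_fin ler1n.
rewrite !big_cons -IH -fineD ?cov_fin //; congr fine.
exact: covarianceDl.
Qed.

(** The value of the form at u is the variance of the combination of the
    X a with weights u a. *)
Lemma quadratic_form_covariance_ge0 (A : finType) (X : A -> Omega -> R)
    (u : A -> R) :
  (forall a, X a \in Lfun Pr 2%:E) ->
  0 <= quadratic_form (covariance_matrix Pr X) u.
Proof.
move=> X2.
have Pfin : Pr setT \is a fin_num := fin_num_measure Pr _ measurableT.
have X1 a : X a \in Lfun Pr 1 by exact: Lfun_subset12.
have uX2 a : (u a \o* X a) \in Lfun Pr 2%:E.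
  by rewrite Lfun_scale // ler1n.
have uX1 a : (u a \o* X a) \in Lfun Pr 1 by exact: Lfun_subset12.
pose S := \sum_a (u a \o* X a).
have S2 : S \in Lfun Pr 2%:E.
  apply: rpred_sum => [|le12 a _]; last exact: uX2.
  by rewrite lee_fin ler1n.
suff -> : quadratic_form (covariance_matrix Pr X) u = fine (variance Pr S).
  by rewrite fine_ge0 // variance_ge0.
rewrite /variance fine_covariance_suml //; apply: eq_bigr => a _.
rewrite covarianceC fine_covariance_suml //; apply: eq_bigr => b _.
rewrite covarianceZl //; last exact: Lfun2_mul_Lfun1.
rewrite covarianceZr //; last exact: Lfun2_mul_Lfun1.
have cov_fin : covariance Pr (X b) (X a) \is a fin_num.
  by rewrite covariance_fin_num // Lfun2_mul_Lfun1.
rewrite !fineM ?fin_numM // /covariance_matrix covarianceC /=; ring.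
Qed.

End CovarianceMatrix.

(** * Profiles of the market game as points of a Euclidean space *)

Section Market.
Context {R : realType} {d : measure_display} {Omega : measurableType d}
  {Pr : probability Omega R}.
Variable M : market Pr.

Definition producer_coord (p : producer M) : finType :=
  (instrument M + {l : fuel M & plant p l} * 'I_(n_delivery M))%type.

(** Strategies are records of functions on finite types; listing the decisions
    of all agents in one row vector gives profiles a norm and a linear
    structure. *)
Definition coord : finType :=
  ({p : producer M & producer_coord p} + consumer M * trade M)%type.

Definition profile := 'rV[R]_#|coord|.

Definition entry (i : coord) (x : profile) : R := x 0 (enum_rank i).

Definition producer_entry p (i : producer_coord p) : profile -> R :=
  entry (inl (Tagged producer_coord i)).

Definition producer_of (x : profile) (p : producer M) : producer_strategy p :=
  ProducerStrategy
    (fun a => producer_entry (inl (inl (inl a)) : producer_coord p) x)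
    (fun b => producer_entry (inl (inl (inr b)) : producer_coord p) x)
    (fun a => producer_entry (inl (inr a) : producer_coord p) x)
    (fun l r j =>
       producer_entry (inr (Tagged (fun l => plant p l) r, j)
                       : producer_coord p) x).

Definition consumer_of (x : profile) (c : consumer M) (a : trade M) : R :=
  entry (inr (c, a)) x.

Definition producer_value (p : producer M) (v : producer_strategy p)
    (i : producer_coord p) : R :=
  match i with
  | inl y => portfolio v y
  | inr (existT l r, j) => Wp v r j
  end.

Definition profile_of (v : forall p : producer M, producer_strategy p)
    (V : consumer M -> trade M -> R) : profile :=
  \row_k match enum_val k with
         | inl (existT p i) => producer_value (v p) i
         | inr (c, a) => V c a
         end.

Lemma producer_of_profile v V : producer_of (profile_of v V) = v.
Proof.
apply: functional_extensionality_dep => p; rewrite /producer_of.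
case vE: (v p) => [Vv Fv Ov Wv].
congr ProducerStrategy; try (apply/funext => a;
  by rewrite /producer_entry /entry mxE enum_rankK /= vE).
apply: functional_extensionality_dep => l.
apply/funext => r; apply/funext => j.
by rewrite /producer_entry /entry mxE enum_rankK /= vE.
Qed.

Lemma consumer_of_profile v V : consumer_of (profile_of v V) = V.
Proof.
apply/funext => c; apply/funext => a.
by rewrite /consumer_of /entry mxE enum_rankK.
Qed.

(** * The feasible set is compact and convex *)

Lemma affine_entry i : affine (entry i).
Proof.
split=> [x|t x y]; first exact: coord_continuous.
by rewrite /entry !mxE.
Qed.

Definition feasible : set profile :=
  [set x | (forall p, S_p (producer_of x p)) /\
           (forall c, S_c c (consumer_of x c))].

Lemma convex_closed_S_p p :
  convex_closed [set x : profile | S_p (producer_of x p)].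
Proof.
apply: convex_closed_and; [apply: convex_closed_and3|apply: convex_closed_and5].
- apply: convex_closed_forall => j; apply: convex_closed_eq.
    by apply: affineN; apply: affine_sum => i; exact: affine_entry.
  by do 2![apply: affine_sum => ?]; exact: affine_entry.
- do 2![apply: convex_closed_forall => ?]; apply: convex_closed_eq.
    by apply: affine_sum => r; apply: affineZ; exact: affine_entry.
  by apply: affine_sum => i; exact: affine_entry.
- apply: convex_closed_eq.
    by do 2![apply: affine_sum => ?]; exact: affine_entry.
  by do 3![apply: affine_sum => ?]; apply: affineZ; exact: affine_entry.
(* The fifth quantifier is the side condition j' = j.+1 on ramping. *)
- do 5![apply: convex_closed_forall => ?].
  apply: convex_closed_and; apply: convex_closed_ler;
    try exact: affine_cst.
    by apply: affineD; [|apply: affineN]; exact: affine_entry.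
  by apply: affineD; [|apply: affineN]; exact: affine_entry.
- do 3![apply: convex_closed_forall => ?].
  by apply: convex_closed_and; apply: convex_closed_ler;
    (exact: affine_cst || exact: affine_entry).
- apply: convex_closed_forall => ?; apply: convex_closed_norm.
  exact: affine_entry.
- apply: convex_closed_forall => ?; apply: convex_closed_norm.
  exact: affine_entry.
- apply: convex_closed_forall => ?; apply: convex_closed_norm.
  exact: affine_entry.
Qed.

Lemma convex_closed_S_c c :
  convex_closed [set x : profile | S_c c (consumer_of x c)].
Proof.
apply: convex_closed_and.
  apply: convex_closed_forall => j.
  apply: convex_closed_eq; last exact: affine_cst.
  by apply: affine_sum => i; exact: affine_entry.
by apply: convex_closed_forall => a; apply: convex_closed_norm;
  exact: affine_entry.
Qed.

Lemma convex_closed_feasible : convex_closed feasible.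
Proof.
apply: convex_closed_and; apply: convex_closed_forall => ?.
  exact: convex_closed_S_p.
exact: convex_closed_S_c.
Qed.

(** Production levels are nonnegative, so the capacity of the plant bounds them
    in absolute value; all other decisions are subject to a trading limit. *)
Definition entry_bound (i : coord) : R :=
  match i with
  | inl (existT p (inl (inl (inl _)))) => V_trade M
  | inl (existT p (inl _)) => F_trade M
  | inl (existT p (inr (existT l r, _))) => capacity r
  | inr _ => V_trade M
  end.

Lemma feasible_bound x i : feasible x -> `|entry i x| <= entry_bound i.
Proof.
move=> [Sp Sc]; case: i => [[p]|[c a]]; last exact: (Sc c).2.
have [_ [_ Wbnd Fbnd Obnd Vbnd]] := Sp p.
case=> [[[a|b]|a]|[[l r] j]]; [exact: Vbnd|exact: Fbnd|exact: Obnd|].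
have [W0 Wcap] := Wbnd l r j.
by rewrite ger0_norm.
Qed.

Lemma compact_feasible : compact feasible.
Proof.
pose I (k : 'I_#|coord|) :=
  `[- entry_bound (enum_val k), entry_bound (enum_val k)]%classic.
have Icompact : compact [set x : profile | forall k, I k (x 0 k)].
  by apply: (@rV_compact R^o _ I) => k; exact: segment_compact.
apply: (subclosed_compact convex_closed_feasible.1 Icompact) => x Fx k.
rewrite /I /= in_itv /= -ler_norml.
by have := feasible_bound (enum_val k) Fx; rewrite /entry enum_valK.
Qed.

(** * The total payoff *)

Definition total_payoff (v : forall p : producer M, producer_strategy p)
    (V : consumer M -> trade M -> R) (E : trade M -> R) : R :=
  \sum_p Psi_p (v p) E + \sum_c Psi_c c (V c) E.

(** Payoffs are affine in the electricity price, so their values at price 0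
    isolate the part of the total that the market agent cannot influence. *)
Definition price_free_payoff (x : profile) : R :=
  total_payoff (producer_of x) (consumer_of x) (fun=> 0).

Lemma price_vec_L2 (i : instrument M) : price_vec i \in Lfun Pr 2%:E.
Proof.
by case: i => [[a|b]|a]; apply: Lfun_scale; rewrite ?ler1n //;
  [exact: electricity_L2|exact: fuel_price_L2|exact: emission_L2].
Qed.

Lemma dot0 (A : finType) (u : A -> R) : dot (fun=> 0) u = 0.
Proof. by rewrite /dot big1 // => a _; rewrite mul0r. Qed.

Lemma Psi_pE (p : producer M) (v : producer_strategy p) (E : trade M -> R) :
  Psi_p v E = Psi_p v (fun=> 0) - dot E (Vp v).
Proof. by rewrite /Psi_p dot0; ring. Qed.

Lemma Psi_cE (c : consumer M) (V E : trade M -> R) :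
  Psi_c c V E = Psi_c c V (fun=> 0) - dot E V.
Proof. by rewrite /Psi_c dot0; ring. Qed.

Lemma affine_dot (A : finType) (u : A -> R) (g : A -> profile -> R) :
  (forall a, affine (g a)) -> affine (fun x => dot u (g^~ x)).
Proof. by move=> ga; apply: affine_sum => a; exact: affineZ. Qed.

Lemma concave_price_free_payoff : concave price_free_payoff.
Proof.
rewrite /price_free_payoff /total_payoff; apply: concaveD; apply: concave_sum.
  move=> p; apply: concaveD.
    apply: concave_affine; apply: affineD; first apply: affineD.
    - by apply: affineN; apply: affine_dot => a; exact: affine_entry.
    - by apply: affineN; apply: affine_dot => a; exact: affine_entry.
    - by apply: affineN; apply: affine_dot => a; exact: affine_entry.
  have portfolioE x : portfolio (producer_of x p) =
      (fun y => producer_entry (inl y : producer_coord p) x).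
    by apply/funext => -[[a|b]|a].
  under eq_fun do rewrite portfolioE.
  apply: concave_quadratic.
  - by move=> u; apply: quadratic_form_covariance_ge0 => i; exact: price_vec_L2.
  - by rewrite divr_ge0 // ltW // producer_risk_gt0.
  - by move=> i; exact: affine_entry.
move=> c; apply: concaveD.
  by apply: concave_affine; apply: affineN; apply: affine_dot => a;
    exact: affine_entry.
apply: concave_quadratic.
- move=> u; apply: quadratic_form_covariance_ge0 => a.
  exact: (price_vec_L2 (inl (inl a))).
- by rewrite divr_ge0 // ltW // consumer_risk_gt0.
- by move=> i; exact: affine_entry.
Qed.

Lemma affine_net_trade a :
  affine (fun x => net_trade (producer_of x) (consumer_of x) a).
Proof. by apply: affineD; apply: affine_sum => ?; exact: affine_entry. Qed.

Lemma S_ME (E : trade M -> R) :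
  S_M E <-> in_box (fun a => Pi_max M * discount a) E.
Proof.
split=> SE a; have := SE a;
  by rewrite /discount normrM (gtr0_norm (expR_gt0 _)) expRN
    ler_pdivlMr ?expR_gt0 // mulrC.
Qed.

(** The market agent's payoff is exactly what the price subtracts from the sum
    of all other payoffs; this identity makes equilibria and saddle points of
    the total payoff correspond. *)
Lemma total_payoffE v V E :
  total_payoff v V E = total_payoff v V (fun=> 0) - Psi_M E v V.
Proof.
have -> : Psi_M E v V = \sum_c dot E (V c) + \sum_p dot E (Vp (v p)).
  rewrite /Psi_M /dot exchange_big [X in _ = _ + X]exchange_big -big_split.
  by apply: eq_bigr => a _; rewrite mulrDr !mulr_sumr.
rewrite /total_payoff (eq_bigr _ (fun p _ => Psi_pE (v p) E)).
rewrite (eq_bigr _ (fun c _ => Psi_cE c (V c) E)) !sumrB; ring.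
Qed.

End Market.

(** * The equilibrium *)

Lemma sum_dfwith_ler {R : realType} (I : finType) (T : I -> Type)
    (F : forall i, T i -> R) (v : forall i, T i) i (u : T i) :
  \sum_j F j (dfwith v i u j) <= \sum_j F j (v j) -> F i u <= F i (v i).
Proof.
rewrite (bigD1 i) // [leRHS](bigD1 i) //= dfwithin.
rewrite (eq_bigr (fun j => F j (v j))) ?lerD2r // => j ji.
by rewrite dfwithout // eq_sym.
Qed.

Theorem corollary3p5 (R : realType) (d : measure_display)
    (Omega : measurableType d) (Pr : probability Omega R) (M : market Pr)
    (hA : strictly_feasible M) :
  exists (v : forall p : producer M, producer_strategy p)
         (V : consumer M -> trade M -> R)
         (E : trade M -> R),
    ((forall p, S_p (v p)) /\ (forall c, S_c c (V c)) /\ S_M E) /\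
    [/\ forall (p : producer M) (u : producer_strategy p),
          S_p u -> Psi_p u E <= Psi_p (v p) E,
        forall (c : consumer M) (U : trade M -> R),
          S_c c U -> Psi_c c U E <= Psi_c c (V c) E
      & forall E' : trade M -> R,
          S_M E' -> Psi_M E' v V <= Psi_M E v V].
Proof.
have K0 : @feasible _ _ _ _ M !=set0.
  have [v [V [vP VP _]]] := hA; exists (profile_of v V).
  split; rewrite ?producer_of_profile ?consumer_of_profile => i.
    have [eqs [ramp cap F O V']] := vP i; split=> //; split.
    - by move=> l r j j' jj'; have [/ltW ? /ltW] := ramp l r j j' jj'.
    - by move=> l r j; have [/ltW ? /ltW] := cap l r j.
    - by move=> b; exact/ltW.
    - by move=> a; exact/ltW.
    - by move=> a; exact/ltW.
  by have [eqs Vlt] := VP i; split=> // a; exact/ltW/Vlt.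
have b0 (a : trade M) : 0 <= Pi_max M * discount a.
  by rewrite mulr_ge0 ?expR_ge0 // ltW // Pi_max_gt0.
have [x Kx [E /S_ME SE saddle]] := saddle_point K0 (@compact_feasible _ _ _ _ M)
  (@convex_closed_feasible _ _ _ _ M) (@concave_price_free_payoff _ _ _ _ M)
  (@affine_net_trade _ _ _ _ M) b0.
set v := producer_of x; set V := consumer_of x.
have {}saddle v' V' E' : (forall p, S_p (v' p)) -> (forall c, S_c c (V' c)) ->
    S_M E' -> total_payoff v' V' E <= total_payoff v V E'.
  move=> Sv' SV' /S_ME SE'; rewrite total_payoffE [leRHS]total_payoffE.
  have := saddle (profile_of v' V') E' _ SE'.
  rewrite /price_free_payoff producer_of_profile consumer_of_profile; apply.
  by split; rewrite ?producer_of_profile ?consumer_of_profile.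
exists v, V, E; split; first by split; [exact: Kx.1|split=> //; exact: Kx.2].
(* A deviation of one producer or consumer changes a single term of the total
   payoff, and all others cancel from the saddle inequality. *)
split=> [p u Su|c U SU|E' SE'].
- apply: (sum_dfwith_ler (F := fun p w => Psi_p w E) (v := v)).
  have := saddle (dfwith v p u) V E; rewrite /total_payoff lerD2r; apply=> //.
    by move=> q; case: dfwithP => // q' _; exact: Kx.1.
  exact: Kx.2.
- apply: (sum_dfwith_ler (F := fun c W => Psi_c c W E) (v := V)).
  have := saddle v (dfwith V c U) E; rewrite /total_payoff lerD2l; apply=> //.
    exact: Kx.1.
  by move=> q; case: dfwithP => // q' _; exact: Kx.2.
- have := saddle v V E' Kx.1 Kx.2 SE'.
  by rewrite total_payoffE [leRHS]total_payoffE lerD2l lerN2.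
Qed.
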